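(* Let $r \geq 2$ be an integer and let $H = (V_1\cup \cdots \cup V_r, E)$ be an $n$-balanced $r$-uniform $r$-partite hypergraph satisfying $|E| = dn$. If $H$ is balanced colorable, then $\chi_b(H) \leq \max\{2,\, r(r-1)d + 1\}$.
   Context: An $r$-uniform hypergraph $H=(V,E)$ (every edge is an $r$-element subset of $V$) is $r$-partite, with partition $V = V_1\cup\cdots\cup V_r$ into disjoint parts, if $|e\cap V_i|=1$ for every $e\in E$ and $i\in[r]$; it is $n$-balanced if $|V_i|=n$ for each $i \in [r]$. A set $I\subseteq V$ is independent if it contains no edge of $H$ as a subset; an independent set $I$ is balanced if $|I\cap V_i| = |I\cap V_j|$ for all $i,j\in[r]$. A proper $q$-coloring is a function $\phi: V\to[q]$ such that each $\phi^{-1}(i)$ is independent; it is balanced if every color class $\phi^{-1}(i)$ is a balanced independent set. $H$ is balanced colorable if it has a balanced proper $q$-coloring for some $q$. The balanced chromatic number $\chi_b(H)$ is the minimum such $q$ ($\infty$ if there is none). Here $d$ is the real number $|E|/n$. *)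

(* Defs.v *)
From mathcomp Require Import all_boot all_order all_algebra.
From mathcomp Require Import boolp reals constructive_ereal.

Set Implicit Arguments.
Unset Strict Implicit.
Unset Printing Implicit Defensive.

Import Order.TTheory GRing.Theory Num.Theory.

Section BalancedColoring.
Variables (V : finType) (r : nat).

(* A hypergraph on the vertex set V is given by its edge set E; the r parts are
   a family P indexed by 'I_r.  Parts may be empty, hence the disjoint-cover
   condition is spelled out instead of using finset's [partition]. *)
Implicit Types (E : {set {set V}}) (P : 'I_r -> {set V}) (I : {set V}).

Definition uniform E : Prop := forall e, e \in E -> #|e| = r.

Definition disjoint_cover P : Prop :=
  (forall i j, i != j -> [disjoint P i & P j]) /\ \bigcup_i P i = [set: V].

Definition partite E P : Prop :=
  disjoint_cover P /\ (forall e i, e \in E -> #|e :&: P i| = 1).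

Definition balanced_parts n P : Prop := forall i, #|P i| = n.

Definition independent E I : bool := [forall e in E, ~~ (e \subset I)].

Definition balanced P I : bool :=
  [forall i, forall j, #|I :&: P i| == #|I :&: P j|].

Definition color_class q (phi : {ffun V -> 'I_q}) (c : 'I_q) : {set V} :=
  [set v | phi v == c].

Definition proper_coloring E q (phi : {ffun V -> 'I_q}) : bool :=
  [forall c, independent E (color_class phi c)].

Definition balanced_coloring E P q (phi : {ffun V -> 'I_q}) : bool :=
  proper_coloring E phi && [forall c, balanced P (color_class phi c)].

Definition balanced_q_colorable E P (q : nat) : bool :=
  [exists phi : {ffun V -> 'I_q}, balanced_coloring E P phi].

Definition balanced_colorable E P : Prop :=
  exists q, balanced_q_colorable E P q.

Definition chi_b (R : realType) E P : \bar R :=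
  match pselect (balanced_colorable E P) with
  | left colE => ((ex_minn colE)%:R)%:E
  | right _ => +oo%E
  end.

End BalancedColoring.

Arguments uniform {V} r E.
Arguments chi_b {V r} R E P.

(* Main.v *)
Require Import Defs.
From mathcomp Require Import all_boot all_order all_algebra.
From mathcomp Require Import boolp reals constructive_ereal.
From mathcomp Require Import zify lra.

Set Implicit Arguments.
Unset Strict Implicit.
Unset Printing Implicit Defensive.

Import Order.TTheory GRing.Theory Num.Theory.

(** Write E(W) for the edges inside a vertex set W that meets every part in m
vertices.  The proof gives the stronger bound max(2, floor(2 |E| / n) + 1),
and 2 d <= r (r - 1) d since r >= 2.  The claim behind it: if W has some
balanced proper coloring, q >= 2 and 2 |E(W)| < q m, then W has one with q
colors.

Colors are removed one at a time, from Q + 1 to Q, as long as 2 |E(W)| < Q m.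
For Q >= 3, compare what is left after deleting each class in turn.  A vertex
survives the removal of all classes but one, and an edge survives the removal
of at most Q - 1 of the Q + 1 classes, because it is not monochromatic.  Hence,
averaging over the Q + 1 classes, some class I of size k in each part satisfies
2 |E(W \ I)| < (Q - 1) (m - k) ([color_part_avg]).  The coloring at hand
restricts to W \ I, so induction on |W| colors W \ I with Q - 1 colors, and I
is the last color.  Starting from exactly Q + 1 classes makes the average come
out right: at most (Q - 1) |E(W)| edges survive in total, against Q m vertices
of each part, and (Q - 1) Q m exceeds 2 (Q - 1) |E(W)|.

When Q = 2, so that |E(W)| < m, two colors are found directly
([two_balanced_colors]).  Fix two parts and shrink every edge to the pair of
its vertices in them: a graph with 2 m vertices and fewer than m edges.  A
2-coloring of this bipartite graph is a union S of components, the first color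
being S on one side and the complement of S on the other; it is balanced exactly
when S has m vertices.  With so few edges a union of components can have any
prescribed size ([closed_subset_of_card]).  The other parts are split
arbitrarily. *)

(** * Unions of components of prescribed size *)

Lemma subset_of_card (T : finType) (X : {set T}) t :
  t <= #|X| -> exists2 S : {set T}, S \subset X & #|S| = t.
Proof.
move=> le_tX; have uX := enum_uniq (mem X).
exists [set x in take t (enum X)].
  by apply/subsetP=> x; rewrite inE => /mem_take; rewrite mem_enum.
rewrite cardsE (card_uniqP (take_uniq _ uX)) size_takel //.
by rewrite -cardE.
Qed.

(** A graph with fewer than N / 2 edges on N vertices has an isolated vertex z.
Delete z and contract an edge xy onto y: this loses one edge and two vertices,
so the hypothesis persists.  A closed set of size t - 1 in the smaller graph
either contains y and is completed by x, or avoids y and is completed by z. *)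
Lemma closed_subset_of_card (T : finType) (es : seq (T * T)) (X : {set T}) t :
    (forall p, p \in es -> p.1 \in X /\ p.2 \in X) ->
    (size es).*2 <= #|X|.-1 -> t <= #|X| ->
  exists S : {set T}, [/\ S \subset X, #|S| = t
    & forall p, p \in es -> (p.1 \in S) = (p.2 \in S)].
Proof.
move: {2}(size es) (erefl (size es)) => k.
elim: k es X t => [|k IHk] [|[x y] es] X t //= szE esX le_eX le_tX.
  by have [S sSX cS] := subset_of_card le_tX; exists S.
case: szE => szE; have [/= xX yX] := esX _ (mem_head _ _).
have esX' p : p \in es -> p.1 \in X /\ p.2 \in X.
  by move=> pe; apply: esX; rewrite inE pe orbT.
have [<-|neq_xy] := eqVneq x y.
  have [|S [sSX cS clS]] := IHk es X t szE esX' _ le_tX; first by lia.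
  by exists S; split=> // p; rewrite inE => /predU1P[->|/clS].
have [->|t_gt0] := posnP t.
  exists set0; rewrite sub0set cards0; split=> // p _; by rewrite !inE.
have [->|neq_tX] := eqVneq t #|X|.
  by exists X; split=> // p /esX[-> ->].
(* There are at most 2 |es| < |X| endpoints, so some z in X is isolated. *)
pose ends := x :: y :: [seq p.1 | p <- es] ++ [seq p.2 | p <- es].
have [z zX z_ends] : exists2 z, z \in X & z \notin ends.
  apply/subsetPn; apply: contraL le_eX => /subset_leq_card leX.
  have := leq_trans leX (card_size ends).
  by rewrite /= size_cat !size_map szE; lia.
move: z_ends; rewrite !inE mem_cat !negb_or.
case/and4P=> neq_zx neq_zy z1 z2.
(* m contracts the edge xy onto y *)
pose m v := if v == x then y else v.
pose X' := X :\ x :\ z.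
have cX' : #|X'| = #|X|.-2.
  have := cardsD1 x X; have := cardsD1 z (X :\ x).
  by rewrite xX !inE neq_zx zX /X'; lia.
have mX' v : v \in X -> v != z -> m v \in X'.
  rewrite /m /X' !inE => vX neq_vz; case: (eqVneq v x) => [_|neq_vx].
    by rewrite yX andbT !(eq_sym y) neq_zy.
  by rewrite neq_vz neq_vx.
have nz p : p \in es -> p.1 != z /\ p.2 != z.
  move=> pe; split; [apply: contraNneq z1 | apply: contraNneq z2] => <-;
  exact: map_f.
have [||||S [sSX cS clS]] := IHk [seq (m p.1, m p.2) | p <- es] X' t.-1.
- by rewrite size_map.
- move=> _ /mapP[p pe ->] /=; have [p1 p2] := esX' _ pe.
  by have [n1 n2] := nz _ pe; split; apply: mX'.
- by rewrite size_map cX'; move: le_eX => /=; lia.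
- by rewrite cX'; lia.
have xS : x \notin S.
  by apply: contraTN isT => /(subsetP sSX); rewrite !inE eqxx andbF.
have zS : z \notin S.
  by apply: contraTN isT => /(subsetP sSX); rewrite !inE eqxx.
pose w := if y \in S then x else z.
have wS : w \notin S by rewrite /w; case: ifP.
have mS v : v != z -> (v \in w |: S) = (m v \in S).
  rewrite /m /w !inE => /negPf neq_vz; case: (eqVneq v x) => [->|/negPf neq_vx].
    rewrite (negPf xS) orbF; case: ifP; rewrite ?eqxx // eq_sym.
    by rewrite (negPf neq_zx).
  by case: ifP; rewrite ?neq_vx ?neq_vz.
exists (w |: S); split.
- rewrite subUset sub1set (subset_trans sSX) ?andbT.
    by rewrite /w; case: ifP.
  exact: subset_trans (subsetDl _ _) (subsetDl _ _).
- by rewrite cardsU1 wS cS; lia.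
- move=> p; rewrite inE => /predU1P[-> /=|pe].
    by rewrite !mS ?(eq_sym _ z) // /m eqxx eq_sym (negPf neq_xy).
  have [n1 n2] := nz _ pe; rewrite !mS //.
  exact: (clS _ (map_f (fun p => (m p.1, m p.2)) pe)).
Qed.

(** * Removing a color class by averaging *)

Section Colorings.
Variables (V : finType) (r : nat) (E : {set {set V}}) (P : 'I_r -> {set V}).
Implicit Types (W I e : {set V}) (f g : V -> nat).

Definition edges_in W := [set e in E | e \subset W].
Definition color_part W f c := [set v in W | f v == c].

(** Colorings take values in nat, so that the number of colors can vary without
casts.  The second clause ranges over all colors, the classes from q on being
empty, so that a coloring with q colors is one with more colors. *)
Definition balanced_colors W q f :=
  (forall v, v \in W -> f v < q) /\
  (forall c, independent E (color_part W f c) && balanced P (color_part W f c)).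

Lemma double_count (S T : finType) (A : {set S}) (R : S -> T -> bool) :
  \sum_c #|[set x in A | R x c]| = \sum_(x in A) #|[set c | R x c]|.
Proof.
under eq_bigr do rewrite -sum1dep_card.
rewrite (exchange_big_dep (mem A)) /= => [|c x _ /andP[]//].
apply: eq_bigr => x xA; rewrite -sum1dep_card.
by apply: eq_bigl => c; rewrite xA.
Qed.

Lemma edge_two_colors W q f e : 0 < #|e| -> balanced_colors W q f ->
  e \in edges_in W -> exists u v, [/\ u \in e, v \in e & f u != f v].
Proof.
move=> /card_gt0P[u ue] [_ fP]; rewrite inE => /andP[eE eW].
have /andP[/forall_inP/(_ _ eE)/subsetPn[v ve]] := fP (f u).
by rewrite inE (subsetP eW) //= eq_sym; exists u, v.
Qed.

(** An edge survives the removal of at most q of the q + 2 classes, since it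
meets at least two of them; a vertex survives the removal of exactly q + 1.  If
every class violated the conclusion, summing over the classes would give
q (q + 1) m <= 2 q |E(W)|. *)
Lemma color_part_avg W m q f i :
    0 < q -> (forall e, e \in E -> 0 < #|e|) -> #|W :&: P i| = m ->
    balanced_colors W q.+2 f -> #|edges_in W|.*2 < q.+1 * m ->
  exists2 c, c < q.+2
    & #|edges_in (W :\: color_part W f c)|.*2
      < q * #|(W :\: color_part W f c) :&: P i|.
Proof.
move=> q_gt0 E0 cW fP ltE.
suff /existsP[c ltc] : [exists c : 'I_q.+2,
    #|edges_in (W :\: color_part W f c)|.*2
      < q * #|(W :\: color_part W f c) :&: P i|] by exists c.
apply: contraLR ltE => /existsPn le_c; rewrite -leqNgt.
(* avoid e c: the edge e survives the removal of color c *)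
pose avoid e (c : 'I_q.+2) := [forall v in e, f v != c].
have sumE : \sum_(c < q.+2) #|edges_in (W :\: color_part W f c)|
    <= q * #|edges_in W|.
  rewrite (eq_bigr (fun c => #|[set e in edges_in W | avoid e c]|)); last first.
    move=> c _; apply: eq_card => e; rewrite !inE -andbA subsetD.
    congr andb; apply: andb_id2l => /subsetP eW.
    rewrite disjoint_subset.
    apply/subsetP/forall_inP => eI v ve; have := eI v ve.
      by rewrite !inE eW.
    by rewrite !inE eW.
  rewrite double_count mulnC -sum_nat_const leq_sum // => e eW.
  have eE : e \in E by move: eW; rewrite inE => /andP[].
  have [u [v [ue ve neq_f]]] := edge_two_colors (E0 _ eE) fP eW.
  have eW' := subsetP (proj2 (andP (etrans (esym (in_set _ _)) eW))).
  pose cu := Ordinal (fP.1 u (eW' u ue)).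
  pose cv := Ordinal (fP.1 v (eW' v ve)).
  have c2 : #|[set cu; cv]| = 2 by rewrite cards2 -val_eqE neq_f.
  have c2C : #|~: [set cu; cv]| = q.
    by apply/eqP; rewrite -(eqn_add2l 2) -{1}c2 cardsC card_ord.
  rewrite -[leqRHS]c2C subset_leq_card //; apply/subsetP=> c.
  rewrite !inE => /forall_inP ec.
  by rewrite negb_or -!val_eqE /= !(eq_sym (c : nat)) !ec.
have sumP : \sum_(c < q.+2) #|(W :\: color_part W f c) :&: P i| = q.+1 * m.
  rewrite (eq_bigr (fun c : 'I_q.+2 => #|[set v in W :&: P i | f v != c]|)).
    rewrite double_count -cW mulnC -sum_nat_const; apply: eq_bigr => v.
    rewrite inE => /andP[vW _]; transitivity #|[set~ Ordinal (fP.1 v vW)]|.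
      by apply: eq_card => c; rewrite !inE -val_eqE eq_sym.
    by rewrite cardsC1 card_ord.
  move=> c _; apply: eq_card => v; rewrite !inE.
  by case: (v \in W) => //=; rewrite andbT andbC.
have: \sum_(c < q.+2) q * #|(W :\: color_part W f c) :&: P i|
   <= \sum_(c < q.+2) #|edges_in (W :\: color_part W f c)| * 2.
  by apply: leq_sum => c _; rewrite muln2 leqNgt le_c.
rewrite -big_distrr -big_distrl /= sumP => le_sum.
rewrite -(leq_pmul2l q_gt0); apply: leq_trans le_sum _.
by rewrite -muln2 mulnA leq_mul2r sumE orbT.
Qed.

(** * Two colors suffice when there are fewer edges than vertices in a part *)

Lemma empty_independent_balanced :
  (forall e, e \in E -> 0 < #|e|) -> independent E set0 && balanced P set0.
Proof.
move=> E0; apply/andP; split; last by do 2!apply/forallP=> ?; rewrite !set0I.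
by apply/forall_inP=> e /E0; rewrite subset0 -cards_eq0 -lt0n.
Qed.

Lemma balanced_of_card I t : (forall i, #|I :&: P i| = t) -> balanced P I.
Proof. by move=> cI; do 2!apply/forallP=> ?; rewrite !cI. Qed.

Lemma card_setD_part W I i : I \subset W ->
  #|(W :\: I) :&: P i| = #|W :&: P i| - #|I :&: P i|.
Proof.
move=> /setIidPr IW; rewrite setIDAC cardsD; congr (_ - #|pred_of_set _|).
by rewrite setIAC IW.
Qed.

Lemma partite_edge_gt0 (i : 'I_r) :
  partite E P -> forall e, e \in E -> 0 < #|e|.
Proof.
by move=> partE e /(partE.2 e i) e1; rewrite -e1 subset_leq_card // subsetIl.
Qed.

(** The set S is a union of components of the graph traced by the edges on the
parts i0 and i1.  The first color A is S on i0 and the complement of S on i1: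
an edge inside A, or inside its complement, would have exactly one end in S.
As |S| = m, the two traces of A have the same size t. *)
Lemma two_balanced_colors W m (i0 i1 : 'I_r) : i0 != i1 -> partite E P ->
    (forall i, #|W :&: P i| = m) -> #|edges_in W| < m ->
  exists f, balanced_colors W 2 f.
Proof.
move=> neq_i [[disjP coverP] EP] cW ltE.
have E0 := partite_edge_gt0 i0 (conj (conj disjP coverP) EP).
have [v0 _] : exists v0, v0 \in W :&: P i0.
  by apply/card_gt0P; rewrite cW; apply: leq_ltn_trans ltE.
(* the vertex of e in part i; the default v0 occurs only when e is not in E *)
pose end_in i e := odflt v0 [pick v in e :&: P i].
have end_inP i e : e \in E -> end_in i e \in e :&: P i.
  move=> eE; rewrite /end_in; case: pickP => //= noe.
  by have := EP e i eE; rewrite (eq_card0 noe).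
have disjP' i j v : v \in P i -> v \in P j -> i = j.
  move=> vi vj; apply/eqP; apply: contraLR vj => /disjP dij.
  by rewrite (disjointFr dij vi).
pose X := W :&: (P i0 :|: P i1).
have cX : #|X| = m.*2.
  rewrite /X setIUr cardsU !cW [_ :&: _ :&: _](_ : _ = set0).
    by rewrite cards0 subn0 addnn.
  apply/setP=> v; rewrite !inE; apply/negP=> /andP[/andP[_ v0i] /andP[_ v1i]].
  by case/eqP: neq_i; apply: disjP' v0i v1i.
have := @closed_subset_of_card V
  [seq (end_in i0 e, end_in i1 e) | e <- enum (edges_in W)] X m.
rewrite size_map -cardE cX => -[||| S [sSX cS clS]].
- move=> _ /mapP[e + ->]; rewrite mem_enum inE => /andP[eE eW] /=.
  have := end_inP i0 e eE; have := end_inP i1 e eE.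
  rewrite !inE => /andP[/(subsetP eW)-> ->] /andP[/(subsetP eW)-> ->].
  by rewrite orbT.
- by rewrite -ltnS prednK ?double_gt0 ?ltn_double //; apply: leq_ltn_trans ltE.
- by rewrite -addnn leq_addr.
have {}clS e : e \in edges_in W -> (end_in i0 e \in S) = (end_in i1 e \in S).
  by move=> eW; apply: (clS (_, _)); apply: map_f; rewrite mem_enum.
pose t := #|S :&: P i0|.
have sSW : S \subset W by apply: subset_trans sSX (subsetIl _ _).
(* |S| = m, so S misses as many vertices of part i1 as it has in part i0. *)
have cS1 : #|(W :&: P i1) :\: S| = t.
  have S01 : S = (S :&: P i0) :|: (S :&: P i1).
    rewrite -setIUr; apply/esym/setIidPl.
    exact: subset_trans sSX (subsetIr _ _).
  have S0 : S :&: P i0 :&: (S :&: P i1) = set0.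
    apply/setP=> v; rewrite !inE; apply/negP=> /andP[/andP[_ v0i] /andP[_ v1i]].
    by case/eqP: neq_i; apply: disjP' v0i v1i.
  have := cardsU (S :&: P i0) (S :&: P i1); rewrite -S01 S0 cards0 subn0 cS.
  have -> : S :&: P i1 = W :&: P i1 :&: S.
    by rewrite setIAC (setIidPr sSW).
  by rewrite cardsD cW /t => ->; rewrite addnK.
have [F FP] : exists F : 'I_r -> {set V}, forall i,
    [/\ F i \subset W :&: P i, #|F i| = t, i = i0 -> F i = S :&: P i0
      & i = i1 -> F i = (W :&: P i1) :\: S].
  apply: (@fin_all_exists 'I_r (fun=> {set V}) (fun i Fi =>
    [/\ Fi \subset W :&: P i, #|Fi| = t, i = i0 -> Fi = S :&: P i0
      & i = i1 -> Fi = (W :&: P i1) :\: S])) => i.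
  have [->|neq0] := eqVneq i i0.
    exists (S :&: P i0); split=> // [|/eqP]; last by rewrite (negPf neq_i).
    by rewrite setSI.
  have [->|neq1] := eqVneq i i1.
    exists ((W :&: P i1) :\: S); split=> //; first exact: subsetDl.
    by move/eqP; rewrite eq_sym (negPf neq_i).
  have [|F sF cF] := @subset_of_card _ (W :&: P i) t.
    rewrite cW -(cW i0) subset_leq_card // setSI //.
  by exists F; split=> // /eqP; rewrite ?(negPf neq0) ?(negPf neq1).
(* the first color, F i being its trace on part i *)
pose A := \bigcup_i F i.
have AP i : A :&: P i = F i.
  apply/setP=> v; rewrite inE; apply/andP/idP => [[/bigcupP[j _ vj] vi]|vF].
    have [/subsetP/(_ v vj)] := FP j; rewrite inE => /andP[_ vPj] _ _ _.
    by rewrite (disjP' _ _ _ vi vPj).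
  have [/subsetP/(_ v vF)] := FP i; rewrite inE => /andP[_ vPi] _ _ _.
  by split=> //; apply/bigcupP; exists i.
have sAW : A \subset W.
  apply/bigcupsP=> i _; have [sF _ _ _] := FP i.
  exact: subset_trans sF (subsetIl _ _).
have A0 e : e \in edges_in W -> (end_in i0 e \in A) = (end_in i0 e \in S).
  rewrite inE => /andP[/(end_inP i0)]; rewrite inE => /andP[_ eP] _.
  have [_ _ /(_ erefl) F0 _] := FP i0.
  by have /setP/(_ (end_in i0 e)) := AP i0; rewrite F0 !inE eP !andbT.
have A1 e : e \in edges_in W -> (end_in i1 e \in A) = (end_in i1 e \notin S).
  rewrite inE => /andP[/(end_inP i1)]; rewrite inE => /andP[ee eP] /subsetP eW.
  have [_ _ _ /(_ erefl) F1] := FP i1.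
  have /setP/(_ (end_in i1 e)) := AP i1.
  by rewrite F1 !inE eP (eW _ ee) !andbT.
pose f v : nat := v \notin A.
have part0 : color_part W f 0 = A.
  apply/setP=> v; rewrite inE /f eqb0 negbK andbC.
  by apply: andb_idr => /(subsetP sAW).
have part1 : color_part W f 1 = W :\: A.
  by apply/setP=> v; rewrite !inE /f eqb1 andbC.
exists f; split=> [v _|[|[|c]]]; first by rewrite /f; case: (v \in A).
- rewrite part0; apply/andP; split.
    apply/forall_inP=> e eE; apply/negP=> eA.
    have eW : e \in edges_in W by rewrite inE eE (subset_trans eA).
    have := end_inP i0 e eE; have := end_inP i1 e eE.
    rewrite !inE => /andP[/(subsetP eA) + _] /andP[/(subsetP eA) + _].
    by rewrite A0 // A1 // clS // => /negPf->.
  apply: (@balanced_of_card _ t) => i; rewrite AP.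
  by have [] := FP i.
- rewrite part1; apply/andP; split.
    apply/forall_inP=> e eE; apply/negP=> eA.
    have eW : e \in edges_in W by rewrite inE eE (subset_trans eA) ?subsetDl.
    have := end_inP i0 e eE; have := end_inP i1 e eE.
    rewrite !inE => /andP[/(subsetP eA) + _] /andP[/(subsetP eA) + _].
    by rewrite !inE A0 // A1 // clS // negbK => /andP[-> _].
  apply: (@balanced_of_card _ (m - t)) => i.
  by rewrite card_setD_part // cW AP; have [_ -> _ _] := FP i.
have -> : color_part W f c.+2 = set0.
  by apply/setP=> v; rewrite !inE /f; case: (v \in A); rewrite andbF.
exact: empty_independent_balanced.
Qed.

(** * Decreasing the number of colors *)

Lemma extend_balanced_colors W q f g c : balanced_colors W q.+2 f ->
  balanced_colors (W :\: color_part W f c) q g ->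
  exists h, balanced_colors W q.+1 h.
Proof.
move=> [_ fP] [g_lt gP].
exists (fun v => if f v == c then q else g v); split=> [v vW|d].
  by case: eqVneq => // fv; rewrite ltnS ltnW // g_lt // !inE vW /= andbT.
have gq : color_part (W :\: color_part W f c) g q = set0.
  apply/setP=> v; rewrite [in RHS]inE [in LHS]inE.
  by apply/negP=> /andP[/g_lt]; rewrite ltn_neqAle => /andP[/negPf->].
have [->|neq_d] := eqVneq d q.
  suff -> : color_part W (fun v => if f v == c then q else g v) q
    = color_part W f c by apply: fP.
  apply/setP=> v; have /setP/(_ v) := gq; rewrite !inE.
  by case: (v \in W); case: (f v == c); rewrite //= eqxx.
suff -> : color_part W (fun v => if f v == c then q else g v) d
  = color_part (W :\: color_part W f c) g d by apply: gP.
apply/setP=> v; rewrite !inE; case: (v \in W) => //=; case: (f v == c) => //=.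
by rewrite eq_sym (negPf neq_d).
Qed.

(** The averaging argument may select an empty class, for which no induction on
|W| is possible; the coloring then already uses one color less, up to renaming
the last color. *)
Lemma drop_empty_color W q f c : c < q.+1 -> balanced_colors W q.+1 f ->
  color_part W f c = set0 -> exists h, balanced_colors W q h.
Proof.
move=> lt_c [f_lt fP] c0.
have neq_c v : v \in W -> f v != c.
  by move=> vW; have /setP/(_ v) := c0; rewrite !inE vW /= => ->.
exists (fun v => if f v == q then c else f v); split=> [v vW|d].
  have := f_lt v vW; have := neq_c v vW.
  by case: (eqVneq (f v) q) => [->|]; lia.
have [->|neq_d] := eqVneq d c.
  suff -> : color_part W (fun v => if f v == q then c else f v) c
    = color_part W f q by apply: fP.
  apply/setP=> v; rewrite !inE; case vW: (v \in W) => //=.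
  by case: ifP; rewrite ?eqxx // (negPf (neq_c v vW)).
have [->|neq_dq] := eqVneq d q.
  suff -> : color_part W (fun v => if f v == q then c else f v) q
    = color_part W f c by apply: fP.
  rewrite c0; apply/setP=> v; rewrite !inE; case vW: (v \in W) => //=.
  have := neq_c v vW; case: ifP => [/eqP-> /negPf|-> //].
  by rewrite eq_sym.
suff -> : color_part W (fun v => if f v == q then c else f v) d
    = color_part W f d by apply: fP.
apply/setP=> v; rewrite !inE; case vW: (v \in W) => //=.
case: ifP => // /eqP->; rewrite !(eq_sym _ d) (negPf neq_dq).
exact: negPf neq_d.
Qed.

Lemma restrict_balanced_colors W q f c : balanced_colors W q f ->
  (forall e, e \in E -> 0 < #|e|) ->
  balanced_colors (W :\: color_part W f c) q f.
Proof.
move=> [f_lt fP] E0; split=> [v|d]; first by rewrite inE => /andP[_ /f_lt].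
have [->|neq_d] := eqVneq d c.
  suff -> : color_part (W :\: color_part W f c) f c = set0.
    exact: empty_independent_balanced.
  by apply/setP=> v; rewrite !inE; case: (v \in W); case: (f v == c).
suff -> : color_part (W :\: color_part W f c) f d = color_part W f d by [].
apply/setP=> v; rewrite !inE; case: (v \in W); rewrite ?andbF //=.
by have [->|] := eqVneq (f v) d; rewrite ?andbF // neq_d.
Qed.

(** The given coloring is improved one color at a time, so the inner induction
is on its number Q of colors; the outer one, on |W|, colors what remains when a
class is removed.  It ranges over all q, because that remainder is colored with
two colors less than the current coloring, whatever the final q is. *)
Lemma balanced_colors_of_few_edges W m q Q f (i0 i1 : 'I_r) :
    i0 != i1 -> partite E P -> (forall i, #|W :&: P i| = m) -> 1 < q ->
    #|edges_in W|.*2 < q * m ->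
  balanced_colors W Q f -> exists g, balanced_colors W q g.
Proof.
move=> neq_i partE.
have E0 := partite_edge_gt0 i0 partE.
have [k] := ubnP #|W|; elim: k => // k IHk in W m q Q f *.
elim: Q f => [|Q IHQ] f leWk cW q_gt1 ltE fP.
  by exists f; split=> [v /fP.1|]; last exact: fP.2.
have [le_Qq|lt_qQ] := leqP Q.+1 q.
  by exists f; split=> [v /fP.1/leq_trans|]; [apply | apply: fP.2].
suff [g gP] : exists g, balanced_colors W Q g by apply: (IHQ g).
have {IHQ}ltE : #|edges_in W|.*2 < Q * m.
  by apply: leq_trans ltE _; rewrite leq_mul2r -ltnS lt_qQ orbT.
have {q_gt1 lt_qQ} Q_gt1 : 1 < Q by lia.
case: Q => [|[|[|Q]]] // in Q_gt1 fP ltE *.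
  apply: (two_balanced_colors neq_i) => //.
  by move: ltE; rewrite mul2n ltn_double.
have [c lt_c ltI] := color_part_avg (ltn0Sn Q.+1) E0 (cW i0) fP ltE.
have [I0|[v vI]] := set_0Vmem (color_part W f c).
  exact: drop_empty_color fP I0.
suff [g gP] : exists g, balanced_colors (W :\: color_part W f c) Q.+2 g.
  exact: extend_balanced_colors fP gP.
apply: (IHk _ _ _ _ f _ _ _ ltI).
- rewrite -ltnS; apply: leq_trans leWk; rewrite ltnS.
  apply: proper_card; apply/properP; split.
    exact: subsetDl.
  exists v; last by rewrite in_setD vI.
  by move: vI; rewrite inE => /andP[].
- move=> i; rewrite !card_setD_part ?cW; last first.
  - by apply/subsetP=> u; rewrite inE => /andP[].
  - by apply/subsetP=> u; rewrite inE => /andP[].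
  by have /andP[_ /forallP/(_ i)/forallP/(_ i0)/eqP->] := fP.2 c.
- by [].
- exact: restrict_balanced_colors fP E0.
Qed.

(** * The balanced chromatic number *)

Lemma balanced_q_colorableP q : (forall e, e \in E -> 0 < #|e|) ->
  balanced_q_colorable E P q <-> exists f, balanced_colors [set: V] q f.
Proof.
move=> E0; split=> [/existsP[phi /andP[/forallP indep /forallP bal]]|].
  exists (fun v => phi v : nat); split=> [v _|c] //.
  have [lt_cq|le_qc] := ltnP c q.
    suff -> : color_part [set: V] (fun v => phi v : nat) c
      = color_class phi (Ordinal lt_cq) by rewrite indep bal.
    by apply/setP=> v; rewrite !inE -val_eqE.
  suff -> : color_part [set: V] (fun v => phi v : nat) c = set0.
    exact: empty_independent_balanced.
  by apply/setP=> v; rewrite !inE ltn_eqF // (leq_trans (ltn_ord _)).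
case=> f [f_lt fP]; pose phi := [ffun v => Ordinal (f_lt v (in_setT v))].
have phiP c : color_class phi c = color_part [set: V] f c.
  by apply/setP=> v; rewrite !inE ffunE -val_eqE.
by apply/existsP; exists phi; apply/andP; split; apply/forallP=> c;
  rewrite phiP; have /andP[] := fP c.
Qed.

Lemma balanced_q_colorable_of_few_edges n q :
    1 < r -> partite E P -> balanced_parts n P -> balanced_colorable E P ->
    1 < q -> #|E|.*2 < q * n -> balanced_q_colorable E P q.
Proof.
move=> r_gt1 partE cP [Q colQ] q_gt1 ltE.
pose i0 := Ordinal (ltnW r_gt1); pose i1 := Ordinal r_gt1.
have neq_i : i0 != i1 by [].
have E0 := partite_edge_gt0 i0 partE.
have [f fP] := (balanced_q_colorableP Q E0).1 colQ.
apply/(balanced_q_colorableP q E0).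
apply: (balanced_colors_of_few_edges neq_i partE _ q_gt1 _ fP) => [i|].
  by rewrite setTI cP.
apply: leq_ltn_trans ltE; rewrite leq_double subset_leq_card //.
by apply/subsetP=> e; rewrite inE => /andP[].
Qed.

(** For the case n = 0, where the number of edges says nothing about d. *)
Lemma empty_balanced_q_colorable q : 1 < r -> partite E P ->
  balanced_parts 0 P -> balanced_q_colorable E P q.
Proof.
move=> r_gt1 partE cP; apply/balanced_q_colorableP.
  exact: partite_edge_gt0 (Ordinal r_gt1) partE.
have V0 (v : V) : false.
  have : v \in [set: V] by rewrite inE.
  by rewrite -partE.1.2 => /bigcupP[i _]; rewrite (cards0_eq (cP i)) inE.
exists (fun=> 0); split=> [v|c]; first by have := V0 v.
have -> : color_part [set: V] (fun=> 0) c = set0.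
  by apply/setP=> v; have := V0 v.
apply: empty_independent_balanced.
exact: partite_edge_gt0 (Ordinal r_gt1) partE.
Qed.

End Colorings.

Local Open Scope ring_scope.

Theorem theorem1p5 (R : realType) (r n : nat) (d : R) (V : finType)
    (E : {set {set V}}) (P : 'I_r -> {set V})
    (r_ge2 : (2 <= r)%N)
    (E_uniform : uniform r E)
    (E_partite : partite E P)
    (P_balanced : balanced_parts n P)
    (card_E : #|E|%:R = d * n%:R)
    (E_colorable : balanced_colorable E P) :
  (chi_b R E P <= (Num.max 2 (r%:R * (r%:R - 1) * d + 1))%:E)%E.
Proof.
rewrite /chi_b; case: pselect => // colE; rewrite lee_fin.
case: ex_minnP => m _ min_m; rewrite le_max.
have [n0|n_gt0] := posnP n.
  rewrite n0 in P_balanced; apply/orP; left; rewrite (ler_nat _ m 2).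
  exact/min_m/empty_balanced_q_colorable.
pose q := (#|E|.*2 %/ n)%N.+1.
have /min_m : balanced_q_colorable E P (maxn 2 q).
  apply: (balanced_q_colorable_of_few_edges r_ge2 E_partite P_balanced) => //.
    by rewrite leq_max.
  by apply: leq_trans (ltn_ceil _ n_gt0) _; rewrite leq_mul2r leq_maxr orbT.
rewrite leq_max => /orP[le_m2|le_mq].
  by rewrite (ler_nat _ m 2) le_m2.
apply/orP; right; apply: le_trans (_ : q%:R <= _); first by rewrite ler_nat.
have n_gt0' : 0 < n%:R :> R by rewrite ltr0n.
have d_ge0 : 0 <= d by rewrite -(pmulr_lge0 _ n_gt0') -card_E.
rewrite -natr1 lerD2r; apply: le_trans (_ : 2 * d <= _).
  rewrite -(ler_pM2r n_gt0') -mulrA -card_E -!natrM ler_nat mul2n.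
  exact: leq_trunc_div.
have r_ge2' : 2 <= r%:R :> R by rewrite (ler_nat _ 2 r).
rewrite ler_wpM2r //; nra.
Qed.
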